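(* There exists a universal constant $C\in(1,\infty)$ such that the following holds. Let $\varepsilon\in(0,1)$, $p\in[2,\infty)$, $K\in[1,\infty)$, and let $n\geqslant 2$ be an integer. Let $X$ be a normed space with $\dim(X)=n$, and let $(Y,\|\cdot\|_Y)$ be an infinite dimensional Banach space whose norm satisfies $$\forall\, x,y\in Y,\qquad 2\|x\|_Y^p+\frac{2}{K^p}\|y\|_Y^p\leqslant \|x+y\|_Y^p+\|x-y\|_Y^p .$$ Then $$\delta_{X\hookrightarrow Y}(\varepsilon)\geqslant e^{-K^p(n/\varepsilon)^{C(n+p)}} .$$
   Context: Distortion: for metric spaces $(S,d_S)$ and $(Y,d_Y)$, the distortion $c_Y(S)$ of $S$ in $Y$ is the infimum over those $D\in[1,\infty]$ for which there exist $f:S\to Y$ and $s\in(0,\infty)$ satisfying $s\,d_S(x,y)\leqslant d_Y(f(x),f(y))\leqslant D s\,d_S(x,y)$ for all $x,y\in S$. Discretization modulus: let $X,Y$ be normed spaces with $\dim(X)<\infty$ and $\dim(Y)=\infty$, and let $B_X$ be the closed unit ball of $X$. For $\varepsilon\in[0,1)$, $\delta_{X\hookrightarrow Y}(\varepsilon)$ is the supremum over those $\delta\in(0,1)$ such that every $\delta$-net $\mathcal{N}_\delta$ of $B_X$ satisfies $c_Y(\mathcal{N}_\delta)\geqslant(1-\varepsilon)c_Y(X)$. Here a $\delta$-net of $B_X$ is a subset $\mathcal{N}_\delta\subseteq B_X$ whose distinct points are at distance at least $\delta$ from each other and such that every point of $B_X$ is at distance at most $\delta$ from some point of $\mathcal{N}_\delta$;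 subsets of $X$ carry the metric induced by the norm of $X$. *)

(* Defs.v *)
From HB Require Import structures.
From mathcomp Require Import all_boot all_order all_algebra.
From mathcomp Require Import all_classical all_reals all_analysis.

Set Implicit Arguments.
Unset Strict Implicit.
Unset Printing Implicit Defensive.

Import Order.TTheory GRing.Theory Num.Theory.
Import numFieldNormedType.Exports.

Local Open Scope classical_set_scope.
Local Open Scope ring_scope.

(* [Vector.axiom n V] is the type of linear bijections V -> 'rV[R]_n. *)
Definition has_dim (R : realType) (V : lmodType R) (n : nat) : Prop :=
  inhabited (Vector.axiom n V).

Definition infinite_dim (R : realType) (V : lmodType R) : Prop :=
  forall n : nat, ~ has_dim V n.

(* The distortion c_Y(S) of (S, dS) in (Y, dY). D ranges over [1, +oo]; since
   +oo * 0 = 0 in \bar R, the upper bound is vacuous for D = +oo. *)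
Definition distortion (R : realType) (S Y : Type)
    (dS : S -> S -> R) (dY : Y -> Y -> R) : \bar R :=
  ereal_inf [set D : \bar R | (1 <= D)%E /\
    exists (f : S -> Y) (s : R), 0 < s /\
      forall x y : S,
        s * dS x y <= dY (f x) (f y) /\
        ((dY (f x) (f y))%:E <= D * (s * dS x y)%:E)%E].

Definition norm_dist (R : realType) (V : normedModType R) (x y : V) : R :=
  `|x - y|.

Definition induced_dist (R : realType) (X : normedModType R) (N : set X)
    (x y : set_type N) : R :=
  norm_dist (set_val x) (set_val y).

Definition unit_ball_net (R : realType) (X : normedModType R) (delta : R)
    (N : set X) : Prop :=
  [/\ N `<=` closed_ball (0 : X) 1,
      forall x y : X, N x -> N y -> x <> y -> delta <= `|x - y| &
      forall x : X, closed_ball (0 : X) 1 x ->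
        exists y : X, N y /\ `|x - y| <= delta].

(* The real supremum of a subset of (0, 1); [sup set0] is 0. *)
Definition discretization_modulus (R : realType) (X Y : normedModType R)
    (eps : R) : R :=
  sup [set delta : R | 0 < delta < 1 /\
    forall N : set X, unit_ball_net delta N ->
      ((1 - eps)%:E * distortion (@norm_dist R X) (@norm_dist R Y)
        <= distortion (@induced_dist R X N) (@norm_dist R Y))%E].

(* Main.v *)
Require Import Defs.
From HB Require Import structures.
From mathcomp Require Import all_boot all_order all_algebra.
From mathcomp Require Import all_classical all_reals all_analysis.
From mathcomp Require Import perm zify ring lra.

Set Implicit Arguments.
Unset Strict Implicit.
Unset Printing Implicit Defensive.

Import Order.TTheory GRing.Theory Num.Theory.
Import numFieldNormedType.Exports.

Local Open Scope classical_set_scope.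
Local Open Scope ring_scope.

(** Let N be a delta-net of the unit ball of X and f : N -> Y an embedding of
distortion D.  One must produce a linear embedding of X into Y of distortion at
most D / (1 - eps).

If D >= 4 n^2 this holds for every infinite dimensional Y: X and some
n-dimensional subspace of Y both have bases that are Auerbach up to a factor 2
([near_auerbach]), and matching two such bases costs at most 4 n^2
([distortion_le_dim]).

If D < 4 n^2, read f along the lattice spanned by 2 delta times a near-Auerbach
basis of X ([net_to_lattice]).  In units of 2 delta this gives a map F on
vectors of natural numbers that is bi-Lipschitz up to an additive error 1.
Divide increments of F over 2^k lattice steps by 2^k to get slopes.  A slope at
scale 2^(k+1) is the mean of two slopes at scale 2^k, and half the difference
of these two is a normalised second difference of F; so p-convexity says that
the p-th moment of the slopes drops, from each dyadic scale to the next, by at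
least K^(-p) times the p-th moment of the second differences
([slope_defect_le]).  Summed over nested boxes of base points this telescopes
([defect_sum]): second differences at all scales together are paid for by the
Lipschitz constant.  Hence if the number m of scales exceeds the number of
tested second differences times K^p (L / eta)^p, up to a factor 2^n for the
boxes, some base point and some scale make all the tested ones at most eta
([exists_flat_scale]).

It suffices to test, at every point of a box of side P, the pairs of directions
(e_i, e_j) and (e_i + e_j, 0): their difference is the mixed second difference
in directions i and j, and a map with small mixed second differences is close to
an affine one ([almost_affine]).  There F is affine up to a bounded error on a
box whose side P is much larger than D n / eps, so that the bi-Lipschitz bounds
of F pass to the linear part with a relative loss of eps ([linearization],
[lattice_to_linear]).  All m dyadic scales must fit between delta and 1, and the
number of tests is (P + 1)^n up to a power of n, while L / eta is polynomial in
n / eps; this is why log (1 / delta) is K^p (n / eps)^(O(n + p))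
([scale_parameters]). *)

(** * Boxes of vectors of natural numbers *)

Lemma ler_sum_mem (R : numDomainType) (I : eqType) (s : seq I) (f g : I -> R) :
  (forall i, i \in s -> f i <= g i) ->
  \sum_(i <- s) f i <= \sum_(i <- s) g i.
Proof. by move=> h; rewrite !big_seq; apply: ler_sum => i; exact: h. Qed.

Definition box (n M : nat) : seq 'rV[nat]_n :=
  [seq map_mx val g | g <- enum {: 'rV['I_M]_n}].

Lemma mem_box (n M : nat) (t : 'rV[nat]_n) :
  (t \in box n M) = [forall i, (t ord0 i < M)%N].
Proof.
apply/mapP/forallP => [[g _ ->] i|ht]; first by rewrite mxE ltn_ord.
exists (\row_i Ordinal (ht i)); first by rewrite mem_enum.
by apply/rowP => i; rewrite !mxE.
Qed.

Lemma box_uniq (n M : nat) : uniq (box n M).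
Proof.
rewrite map_inj_uniq ?enum_uniq // => g g' /rowP eqg.
by apply/rowP => i; apply: val_inj; move: (eqg i); rewrite !mxE.
Qed.

Lemma size_box (n M : nat) : size (box n M) = (M ^ n)%N.
Proof. by rewrite size_map -cardT card_mx card_ord mul1n. Qed.

(** Replaces translation invariance of a mean: a translate of the smaller box is
a part of the larger one. *)
Lemma box_sum_shift (R : realType) (n M M' : nat) (u : 'rV[nat]_n)
    (g : 'rV[nat]_n -> R) :
  (forall t, 0 <= g t) ->
  (forall t, t \in box n M' -> t + u \in box n M) ->
  \sum_(t <- box n M') g (t + u) <= \sum_(t <- box n M) g t.
Proof.
move=> g0 sub; rewrite -(big_map (fun t => t + u) xpredT g).
set s := map _ _.
have us : uniq s.
  rewrite map_inj_uniq ?box_uniq // => a b /rowP eab.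
  by apply/rowP => i; move: (eab i); rewrite !mxE; apply: addIn.
rewrite [leRHS](bigID (mem s)) /= -[X in _ <= X + _]big_filter.
rewrite [X in _ <= X + _](perm_big s) /=; first by rewrite lerDl sumr_ge0.
apply: uniq_perm => //; first by rewrite filter_uniq // box_uniq.
move=> t; rewrite mem_filter; case: (boolP (t \in s)) => //= /mapP[t' ht' ->].
exact: sub.
Qed.

Lemma coord_addMn (n : nat) (t u : 'rV[nat]_n) (c : nat) (i : 'I_n) :
  (t + u *+ c) ord0 i = (t ord0 i + u ord0 i * c)%N.
Proof.
rewrite mxE mulmxnE; congr (_ + _)%N.
by elim: c => [|c ih]; rewrite ?muln0 // mulrS ih mulnS.
Qed.

Definition unitv (n : nat) (i : 'I_n) : 'rV[nat]_n :=
  \row_j nat_of_bool (j == i).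

Definition l1 (n : nat) (b : 'rV[nat]_n) : nat := (\sum_i b ord0 i)%N.

Lemma coord_add_unitv (n : nat) (a : 'rV[nat]_n) (i j : 'I_n) :
  (a + unitv j) ord0 i = (a ord0 i + (i == j))%N.
Proof. by rewrite !mxE. Qed.

Lemma l1_add_unitv (n : nat) (a : 'rV[nat]_n) (j : 'I_n) :
  l1 (a + unitv j) = (l1 a).+1.
Proof.
rewrite /l1; under eq_bigr => i _ do rewrite coord_add_unitv.
rewrite big_split /=; suff -> : (\sum_(i < n) (i == j) = 1)%N by rewrite addn1.
by rewrite (bigD1 j) //= eqxx big1 // => i /negPf ->.
Qed.

Lemma nat_vector_ind (n : nat) (Q : 'rV[nat]_n -> Prop) :
  Q 0 -> (forall a j, Q a -> Q (a + unitv j)) -> forall b, Q b.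
Proof.
move=> Q0 QS b; have [m] := ubnP (l1 b).
elim: m b => // m ih b; rewrite ltnS => lb.
have [/existsP[j bj]|/existsPn b0] := boolP [exists j, (0 < b ord0 j)%N]; last first.
  suff -> : b = 0 by [].
  by apply/rowP => i; rewrite [RHS]mxE; apply/eqP; rewrite -leqn0 leqNgt; exact: b0.
have eb : b = (\row_i (b ord0 i - (i == j))%N) + unitv j.
  apply/rowP => i; rewrite coord_add_unitv mxE subnK //.
  by case: eqP => [->|].
rewrite eb; apply: QS; apply: ih.
by have := lb; rewrite {1}eb l1_add_unitv.
Qed.

Lemma box_add_unitv (n P : nat) (a : 'rV[nat]_n) (j : 'I_n) :
  a + unitv j \in box n P -> a \in box n P.
Proof.
rewrite !mem_box => /forallP h; apply/forallP => i.
by apply: leq_ltn_trans (h i); rewrite coord_add_unitv leq_addr.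
Qed.

Lemma l1_box (n P : nat) (b : 'rV[nat]_n) : b \in box n P.+1 -> (l1 b <= n * P)%N.
Proof.
rewrite mem_box => /forallP hb.
by rewrite -[X in (X * _)%N]card_ord -sum_nat_const; apply: leq_sum => i _; exact: hb.
Qed.

Lemma box0 (n P : nat) : 0 \in box n P.+1.
Proof. by rewrite mem_box; apply/forallP => j; rewrite mxE. Qed.

Lemma unitv_box (n P : nat) (i : 'I_n) : unitv i \in box n P.+2.
Proof. by rewrite mem_box; apply/forallP => j; rewrite mxE; case: (j == i). Qed.

(** * Uniform convexity and second differences across dyadic scales *)

Definition p_convex (R : realType) (Y : normedModType R) (p K : R) : Prop :=
  forall x y : Y,
    2 * `|x| `^ p + 2 / K `^ p * `|y| `^ p <= `|x + y| `^ p + `|x - y| `^ p.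

(** The increment between the two points reached from [t] in directions [u] and
[v], rather than along one direction: differences such as e_i - e_j are then
available while all vectors stay nonnegative. *)
Definition slope (R : realType) (Y : normedModType R) (n : nat)
    (F : 'rV[nat]_n -> Y) (u v : 'rV[nat]_n) (k : nat) (t : 'rV[nat]_n) : Y :=
  2^-1 ^+ k *: (F (t + u *+ 2 ^ k) - F (t + v *+ 2 ^ k)).

(** The midpoint of the two end points is reached after 2^k steps in direction
[u + v], so this is a second difference of [F] in direction [u - v]. *)
Definition defect (R : realType) (Y : normedModType R) (n : nat)
    (F : 'rV[nat]_n -> Y) (u v : 'rV[nat]_n) (k : nat) (t : 'rV[nat]_n) : Y :=
  2^-1 ^+ k.+1 *: (F (t + u *+ 2 ^ k.+1) + F (t + v *+ 2 ^ k.+1)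
                   - F (t + (u + v) *+ 2 ^ k) *+ 2).

(** The sum and the difference are the slopes of the two halves of the segment
from [t + 2^(k+1) v] to [t + 2^(k+1) u]. *)
Lemma slope_defect (R : realType) (Y : normedModType R) (n : nat)
    (F : 'rV[nat]_n -> Y) (u v : 'rV[nat]_n) (k : nat) (t : 'rV[nat]_n) :
  slope F u v k.+1 t + defect F u v k t = slope F u v k (t + u *+ 2 ^ k) /\
  slope F u v k.+1 t - defect F u v k t = slope F u v k (t + v *+ 2 ^ k).
Proof.
have e2 (w : 'rV[nat]_n) : t + w *+ 2 ^ k + w *+ 2 ^ k = t + w *+ 2 ^ k.+1.
  by rewrite -addrA -mulrnDr addnn -mul2n -expnS.
have euv : t + u *+ 2 ^ k + v *+ 2 ^ k = t + (u + v) *+ 2 ^ k.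
  by rewrite mulrnDl addrA.
have evu : t + v *+ 2 ^ k + u *+ 2 ^ k = t + (u + v) *+ 2 ^ k.
  by rewrite addrAC euv.
have half : (2^-1 ^+ k : R) = 2^-1 ^+ k.+1 *+ 2.
  by rewrite exprS; set x := _ ^+ k; rewrite mulr2n; lra.
rewrite /slope /defect !e2 euv evu half -[in X in _ = X /\ _]scalerMnl.
rewrite -[in X in _ /\ _ = X]scalerMnl !scalerMnr -scalerDr -scalerBr.
set A := F _; set B := F _; set M := F _.
split; congr (_ *: _).
  by rewrite [A + B]addrC !addrA subrK mulrnBl mulr2n.
rewrite opprB addrCA; have -> : A - B - (A + B) = - (B *+ 2).
  by rewrite opprD addrA [A - B]addrC addrK mulr2n opprD.
by rewrite mulrnBl.
Qed.

Lemma slope_defect_le (R : realType) (Y : normedModType R) (p K : R) (n : nat)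
    (F : 'rV[nat]_n -> Y) (u v : 'rV[nat]_n) (k : nat) (t : 'rV[nat]_n) :
  p_convex Y p K ->
  2 * `|slope F u v k.+1 t| `^ p + 2 / K `^ p * `|defect F u v k t| `^ p
    <= `|slope F u v k (t + u *+ 2 ^ k)| `^ p
       + `|slope F u v k (t + v *+ 2 ^ k)| `^ p.
Proof.
move=> /(_ (slope F u v k.+1 t) (defect F u v k t)).
by have [-> ->] := slope_defect F u v k t.
Qed.

(** If [S k] is the sum of the p-th powers of the slopes over the k-th box, then
[slope_defect_le] and the nesting of the boxes give
2 S(k+1) + 2 K^(-p) B(k) <= 2 S(k), which telescopes. *)
Lemma defect_sum (R : realType) (Y : normedModType R) (p K : R) (n : nat)
    (F : 'rV[nat]_n -> Y) (u v : 'rV[nat]_n) (M : nat -> nat) (m : nat) :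
  0 < K -> p_convex Y p K ->
  (forall k t, (k < m)%N -> t \in box n (M k.+1) ->
     t + u *+ 2 ^ k \in box n (M k) /\ t + v *+ 2 ^ k \in box n (M k)) ->
  \sum_(k < m) \sum_(t <- box n (M k.+1)) `|defect F u v k t| `^ p
    <= K `^ p * \sum_(t <- box n (M 0)) `|slope F u v 0 t| `^ p.
Proof.
move=> K0 cvx sub; have Kp0 : 0 < K `^ p by exact: powR_gt0.
pose S k := \sum_(t <- box n (M k)) `|slope F u v k t| `^ p.
pose B k := \sum_(t <- box n (M k.+1)) `|defect F u v k t| `^ p.
have step k : (k < m)%N -> B k <= K `^ p * (S k - S k.+1).
  move=> km; have h : 2 * S k.+1 + 2 / K `^ p * B k <= S k + S k.
    apply: (@le_trans _ _ (\sum_(t <- box n (M k.+1))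
        (`|slope F u v k (t + u *+ 2 ^ k)| `^ p
         + `|slope F u v k (t + v *+ 2 ^ k)| `^ p))).
      rewrite /S /B !mulr_sumr -big_split /=; apply: ler_sum => t _.
      exact: slope_defect_le.
    rewrite big_split; apply: lerD.
      apply: (box_sum_shift (g := fun t => `|slope F u v k t| `^ p)) => [t|t ht].
        exact: powR_ge0.
      by have [] := sub k t km ht.
    apply: (box_sum_shift (g := fun t => `|slope F u v k t| `^ p)) => [t|t ht].
      exact: powR_ge0.
    by have [] := sub k t km ht.
  rewrite -ler_pdivrMl //; nra.
have : \sum_(k < m) B k <= K `^ p * (S 0%N - S m).
  elim: m step {sub} => [|m ih] step.
    by rewrite big_ord0 subrr mulr0.
  rewrite big_ord_recr /=.
  have := ih (fun k km => step k (leqW km)); have := step m (ltnSn m).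
  nra.
move=> /le_trans; apply; apply: ler_wpM2l; first exact: ltW.
by rewrite gerBl sumr_ge0 // => t _; exact: powR_ge0.
Qed.

(** Pigeonhole.  Were the conclusion false, the p-th powers of the defects at
each scale and base point would add up to at least eta^p, which after summation
over the [m] scales and over the base points of a box contradicts [defect_sum].
The factor 2 inside the n-th power compares the largest box of base points with
the smallest one. *)
Lemma exists_flat_scale (R : realType) (Y : normedModType R) (p K L eta : R)
    (n m P : nat) (D : finType) (u v : D -> 'rV[nat]_n)
    (F : 'rV[nat]_n -> Y) :
  0 < p -> 0 < K -> p_convex Y p K -> 0 <= L -> 0 < eta ->
  (forall d i, (u d ord0 i <= 2)%N /\ (v d ord0 i <= 2)%N) ->
  (forall d t, t \in box n (2 ^ m.+1 * P.+2) ->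
     `|F (t + u d) - F (t + v d)| <= L) ->
  (#|D| * (2 * P.+1) ^ n)%:R * K `^ p * (L / eta) `^ p < m%:R ->
  exists k t, [/\ (k < m)%N, t \in box n (2 ^ m * P.+2) &
    forall d a, a \in box n P.+1 ->
      `|defect F (u d) (v d) k (t + a *+ 2 ^ k.+1)| <= eta].
Proof.
move=> p0 K0 cvx L0 eta0 le2 lipF hm.
have Kp0 : 0 < K `^ p by exact: powR_gt0.
have etap0 : 0 < eta `^ p by exact: powR_gt0.
pose Mf := (2 ^ m * P.+2)%N.
(* Between scales k and k + 1 the box loses 2 * 2^k, room for a step 2^k u with
   coordinates of u at most 2; the summand 2^m P is room for the base points
   t + 2^(k+1) a. *)
pose M k := (Mf + 2 ^ m * P + 2 * (2 ^ m - 2 ^ k))%N.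
have pow2 k : (k < m)%N -> (2 ^ k.+1 <= 2 ^ m)%N by move=> km; rewrite leq_exp2l.
have subM d k t : (k < m)%N -> t \in box n (M k.+1) ->
    t + u d *+ 2 ^ k \in box n (M k) /\ t + v d *+ 2 ^ k \in box n (M k).
  move=> km; rewrite !mem_box => /forallP ht; have := pow2 k km.
  rewrite expnS => k2; split; apply/forallP => i; have := ht i;
    have [ul vl] := le2 d i; rewrite coord_addMn /M expnS; nia.
have M0le : (M 0 <= 2 * Mf)%N.
  by rewrite /M /Mf expn0; have := expn_gt0 2 m; nia.
apply: contrapT => nex.
(* With the conclusion negated, some defect is large at every scale and base
   point. *)
have big k t : (k < m)%N -> t \in box n Mf ->
    eta `^ p <= \sum_(d : D) \sum_(a <- box n P.+1)
                  `|defect F (u d) (v d) k (t + a *+ 2 ^ k.+1)| `^ p.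
  move=> km ht; apply: contrapT => /negP; rewrite -ltNge => small.
  apply: nex; exists k, t; split => // d a ha; rewrite leNgt; apply/negP => large.
  move: small; apply/negP; rewrite -leNgt (bigD1 d) //= (bigD1_seq a) ?box_uniq //=.
  rewrite -addrA; apply: ler_wpDr.
    by rewrite addr_ge0 ?sumr_ge0 // => *; rewrite ?sumr_ge0 // => *; rewrite powR_ge0.
  by apply: ge0_ler_powR; rewrite ?nnegrE ?(ltW p0) // ltW.
have upper d a : a \in box n P.+1 ->
    \sum_(k < m) \sum_(t <- box n Mf) `|defect F (u d) (v d) k (t + a *+ 2 ^ k.+1)| `^ p
      <= K `^ p * (((2 * Mf) ^ n)%:R * L `^ p).
  move=> ha.
  apply: (@le_trans _ _ (\sum_(k < m) \sum_(t <- box n (M k.+1))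
                           `|defect F (u d) (v d) k t| `^ p)).
    apply: ler_sum => k _.
    apply: (box_sum_shift (g := fun t => `|defect F (u d) (v d) k t| `^ p)) => [t|t].
      exact: powR_ge0.
    move: ha; rewrite !mem_box => /forallP ha /forallP ht; apply/forallP => i.
    have := ha i; have := ht i; have := pow2 k (ltn_ord k).
    by rewrite coord_addMn /M; nia.
  apply: (le_trans (defect_sum (M := M) F K0 cvx (subM d))).
  apply: ler_wpM2l; first exact: ltW.
  apply: (@le_trans _ _ (\sum_(t <- box n (M 0)) L `^ p)).
    apply: ler_sum_mem => t ht; apply: ge0_ler_powR; rewrite ?nnegrE ?(ltW p0) //.
    rewrite /slope expr0 scale1r expn0 !mulr1n lipF //.
    move: ht; rewrite !mem_box => /forallP ht; apply/forallP => i.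
    by apply: leq_trans (ht i) (leq_trans M0le _); rewrite /Mf expnS mulnA.
  rewrite big_const_seq count_predT size_box iter_addr_0 -[leLHS]mulr_natl.
  apply: ler_wpM2r; rewrite ?powR_ge0 // ler_nat.
  by case: (n) => // n'; rewrite leq_exp2r.
have total : m%:R * (Mf ^ n)%:R * eta `^ p
    <= (#|D| * P.+1 ^ n)%:R * (K `^ p * (((2 * Mf) ^ n)%:R * L `^ p)).
  apply: (@le_trans _ _ (\sum_(k < m) \sum_(t <- box n Mf) \sum_(d : D)
     \sum_(a <- box n P.+1) `|defect F (u d) (v d) k (t + a *+ 2 ^ k.+1)| `^ p)).
    apply: (@le_trans _ _ (\sum_(k < m) \sum_(t <- box n Mf) eta `^ p)).
      rewrite sumr_const card_ord big_const_seq count_predT size_box iter_addr_0.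
      by rewrite -[leRHS]mulr_natl -[X in _ <= _ * X]mulr_natl mulrA.
    apply: ler_sum => k _; apply: ler_sum_mem => t ht; exact: big.
  under eq_bigr => k _ do rewrite exchange_big.
  rewrite exchange_big /=.
  apply: (@le_trans _ _ (\sum_(d : D) \sum_(a <- box n P.+1)
      K `^ p * (((2 * Mf) ^ n)%:R * L `^ p))).
    apply: ler_sum => d _.
    under eq_bigr => k _ do rewrite exchange_big.
    rewrite exchange_big /=; apply: ler_sum_mem => a ha; exact: upper.
  rewrite sumr_const big_const_seq count_predT size_box iter_addr_0.
  by rewrite -mulrnA -[leLHS]mulr_natl mulnC (@eq_card _ xpredT D).
have Mf0 : 0 < (Mf ^ n)%:R :> R by rewrite ltr0n expn_gt0 muln_gt0 expn_gt0.
move: hm; apply/negP; rewrite -leNgt.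
have etaLp : L `^ p = (L / eta) `^ p * eta `^ p.
  by rewrite -powRM ?divfK ?gt_eqF // ?divr_ge0 // ltW.
rewrite -(ler_pM2r (mulr_gt0 Mf0 etap0)) mulrA (le_trans total) //.
rewrite etaLp !expnMn !natrM.
by rewrite le_eqVlt; apply/orP; left; apply/eqP; ring.
Qed.

(** * Small mixed second differences force affinity *)

(** Walking from 0 to [b] by unit steps, an increment in direction j moves away
from its value at 0 by at most [theta] per step, hence by [theta * l1 b] at most;
the walk itself has [l1 b] steps. *)
Lemma almost_affine (R : realType) (Y : normedModType R) (n P : nat)
    (theta : R) (w : 'rV[nat]_n -> Y) :
  0 <= theta ->
  (forall a i j, a \in box n P.+1 ->
     `|w (a + unitv i + unitv j) - w (a + unitv i) - (w (a + unitv j) - w a)|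
       <= theta) ->
  forall b, b \in box n P.+1 ->
    `|w b - w 0 - \sum_i (b ord0 i)%:R *: (w (unitv i) - w 0)|
      <= theta * (n * P)%:R ^+ 2.
Proof.
move=> theta0 flat b hb.
apply: (@le_trans _ _ (theta * (l1 b)%:R ^+ 2)); last first.
  by apply: ler_wpM2l => //; rewrite ler_pXn2r ?nnegrE ?ler_nat ?l1_box.
have incr a j : a \in box n P.+1 ->
    `|w (a + unitv j) - w a - (w (unitv j) - w 0)| <= theta * (l1 a)%:R.
  elim/nat_vector_ind: a => [|a i ih] ha.
    by rewrite add0r subrr normr0 mulr_ge0.
  have ha' := box_add_unitv ha.
  rewrite l1_add_unitv -[(l1 a).+1%:R]natr1 mulrDr mulr1 [leRHS]addrC.
  have := lerD (flat a i j ha') (ih ha'); apply: le_trans.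
  by rewrite -[X in `|X|](subrKA (w (a + unitv j) - w a)) ler_normD.
elim/nat_vector_ind: b hb => [|a j ih] ha.
  rewrite subrr sub0r normrN big1 ?normr0 ?mulr_ge0 // => i _.
  by rewrite mxE scale0r.
have ha' := box_add_unitv ha.
have -> : \sum_i ((a + unitv j)%R ord0 i)%:R *: (w (unitv i) - w 0)
    = \sum_i (a ord0 i)%:R *: (w (unitv i) - w 0) + (w (unitv j) - w 0).
  under eq_bigr => i _ do rewrite coord_add_unitv natrD scalerDl.
  rewrite big_split /=; congr (_ + _).
  by rewrite (bigD1 j) //= eqxx scale1r big1 ?addr0 // => i /negPf ->; rewrite scale0r.
set A := \sum_i _; set D := w (unitv j) - w 0.
have -> : w (a + unitv j) - w 0 - (A + D)
    = (w (a + unitv j) - w a - D) + (w a - w 0 - A).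
  by rewrite [RHS]addrACA subrKA opprD [- A + - D]addrC.
apply: le_trans (ler_normD _ _) _.
apply: le_trans (lerD (incr _ _ ha') (ih ha')) _.
rewrite l1_add_unitv -mulrDr ler_wpM2l // -[(l1 a).+1%:R]natr1.
by have := ler0n R (l1 a); nra.
Qed.

(** * Near-Auerbach bases *)

(** Families of vectors, through this map on coordinates, stand for linear
operators throughout. *)
Definition comb (R : realType) (V : normedModType R) (n : nat) (e : 'I_n -> V)
  (a : 'rV[R]_n) : V := \sum_i a ord0 i *: e i.

Lemma comb_linear (R : realType) (V : normedModType R) (n : nat) (e : 'I_n -> V) :
  linear (comb e).
Proof.
move=> k a b; rewrite /comb scaler_sumr -big_split; apply: eq_bigr => i _.
by rewrite !mxE scalerDl scalerA.
Qed.

HB.instance Definition _ (R : realType) (V : normedModType R) (n : nat)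
    (e : 'I_n -> V) :=
  GRing.isLinear.Build R 'rV[R]_n V *:%R (comb e) (comb_linear e).

Definition free_family (R : realType) (V : normedModType R) (n : nat)
  (e : 'I_n -> V) : Prop := forall a, comb e a = 0 -> a = 0.

Lemma norm_coord (R : realType) (n : nat) (a : 'rV[R]_n) (i : 'I_n) :
  `|a ord0 i| <= `|a|.
Proof.
rewrite [leRHS]/Num.norm /= mx_normrE; apply/bigmax_geP; right => /=.
by exists (ord0, i).
Qed.

Lemma comb_continuous (R : realType) (V : normedModType R) (n : nat) (e : 'I_n -> V) :
  continuous (comb e).
Proof.
rewrite /comb; elim: (index_enum _) => [|i s ih].
  under eq_fun do rewrite big_nil.
  exact: cst_continuous.
under eq_fun do rewrite big_cons.
move=> a; apply: (@continuousD _ V 'rV[R]_n (fun b => b ord0 i *: e i)); last exact: ih.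
have coord : {for a, continuous (fun b : 'rV[R]_n => b ord0 i : R^o)}.
  exact: coord_continuous.
exact: (@cvgZr_tmp R V _ _ _ _ _ (e i) coord).
Qed.

(** The norm of [comb e a] has a positive minimum on the compact unit sphere of
coordinate vectors. *)
Lemma comb_coercive (R : realType) (V : normedModType R) (n : nat) (e : 'I_n -> V) :
  free_family e -> exists2 c : R, 0 < c & forall a, `|a| <= c * `|comb e a|.
Proof.
move=> efree; pose S := [set a : 'rV[R]_n | `|a| = 1].
have [S0|/set0P S0] := eqVneq S set0.
  exists 1 => // a; have [->|a0] := eqVneq a 0; first by rewrite linear0 !normr0 mulr0.
  suff : S (`|a|^-1 *: a) by rewrite S0.
  by rewrite /S /= normrZ normfV normr_id mulVf // normr_eq0.
have Scompact : compact S.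
  apply: bounded_closed_compact.
    exists 1; split => // M M1 a /= ->; exact: ltW.
  rewrite (_ : S = Num.norm @^-1` [set x : R | x = 1]) //.
  apply: closed_comp; last exact: closed_eq.
  by move=> a _; exact: norm_continuous.
have cont : {within S, continuous (fun a => `|comb e a|)}.
  apply: continuous_subspaceT => a.
  apply: (@continuous_comp _ _ _ (comb e) Num.norm); first exact: comb_continuous.
  exact: norm_continuous.
have [b bS bmin] := EVT_min_rV S0 Scompact cont.
move: bS; rewrite inE /S /= => b1.
have cb0 : 0 < `|comb e b|.
  rewrite normr_gt0; apply/eqP => /efree b0.
  by move: b1; rewrite b0 normr0 => /esym/eqP; rewrite oner_eq0.
exists (`|comb e b|^-1); first by rewrite invr_gt0.
move=> a; have [->|a0] := eqVneq a 0; first by rewrite linear0 !normr0 mulr0.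
have na0 : 0 < `|a| by rewrite normr_gt0.
rewrite mulrC ler_pdivlMr // mulrC -ler_pdivlMr //.
have := bmin (`|a|^-1 *: a); rewrite inE linearZ /= normrZ normfV normr_id mulrC.
by apply; rewrite /S /= normrZ normfV normr_id mulVf // gt_eqF.
Qed.

Lemma det_bounded (R : realType) (n : nat) (c : R) (A : 'M[R]_n) :
  0 <= c -> (forall i j, `|A i j| <= c) -> `|\det A| <= (n`!)%:R * c ^+ n.
Proof.
move=> c0 hA; apply: le_trans (ler_norm_sum _ _ _) _.
apply: (@le_trans _ _ (\sum_(s : 'S_n) c ^+ n)).
  apply: ler_sum => s _; rewrite normrM normrX normrN1 expr1n mul1r normr_prod.
  rewrite -[in leRHS](card_ord n) -prodr_const.
  by apply: ler_prod => i _; rewrite normr_ge0 hA.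
by rewrite sumr_const card_Sn mulr_natl.
Qed.

(** Cramer's rule, from the expansion along row [i]: the cofactors of that row
are those of [A]. *)
Lemma det_replace_row (R : comNzRingType) (n : nat) (A : 'M[R]_n)
    (b : 'rV[R]_n) (i : 'I_n) :
  \det (\matrix_(k, j) if k == i then (b *m A) ord0 j else A k j)
    = b ord0 i * \det A.
Proof.
rewrite (expand_det_row _ i).
under eq_bigr => j _.
  rewrite mxE eqxx (_ : cofactor _ i j = (\adj A) j i); first over.
  rewrite mxE /cofactor; congr (_ * \det _).
  by apply/matrixP => k l; rewrite !mxE eq_sym (negPf (neq_lift _ _)).
rewrite /=.
transitivity ((b *m A *m \adj A) ord0 i); first by rewrite [RHS]mxE.
by rewrite -mulmxA mul_mx_adj mul_mx_scalar mxE mulrC.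
Qed.

(** Take n vectors of the unit ball whose determinant, in the coordinates of
[e], is more than half the supremum.  By [det_replace_row], exchanging one of them
for a unit vector multiplies the determinant by a coordinate of that vector, so
this coordinate is at most 2.  A factor 2 is given up so that no maximiser is
needed. *)
Lemma near_auerbach (R : realType) (V : normedModType R) (n : nat) (e : 'I_n -> V) :
  free_family e ->
  exists f : 'I_n -> V, [/\ forall i, `|f i| <= 1,
    forall (a : 'rV[R]_n) i, `|a ord0 i| <= 2 * `|comb f a| &
    forall a, exists b, comb e a = comb f b].
Proof.
move=> efree; have [c c0 hc] := comb_coercive efree.
pose E := [set r : R | exists A : 'M[R]_n,
  (forall i, `|comb e (row i A)| <= 1) /\ r = `|\det A|].
have Ebd : has_ubound E.
  exists ((n`!)%:R * c ^+ n) => r [A [hA ->]].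
  apply: det_bounded => [|i j]; first exact: ltW.
  have := norm_coord (row i A) j; rewrite mxE => /le_trans; apply.
  apply: le_trans (hc _) _; rewrite -[leRHS]mulr1; apply: ler_wpM2l => //; exact: ltW.
have [r0 Er0 r00] : exists2 r, E r & 0 < r.
  pose s := 1 + \sum_i `|e i|; have s0 : 0 < s by rewrite ltr_pwDl ?sumr_ge0.
  exists (`|\det (s^-1%:M : 'M[R]_n)|); last first.
    by rewrite normr_gt0 det_scalar expf_neq0 // invr_eq0 gt_eqF.
  exists (s^-1%:M); split => // i.
  have -> : row i (s^-1%:M : 'M[R]_n) = s^-1 *: delta_mx 0 i.
    by apply/rowP => j; rewrite !mxE eqxx mulr_natr eq_sym.
  rewrite linearZ /= normrZ gtr0_norm ?invr_gt0 // ler_pdivrMl // mulr1.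
  have -> : comb e (delta_mx 0 i) = e i.
    rewrite /comb (bigD1 i) //= big1 => [|j ji].
      by rewrite mxE !eqxx scale1r addr0.
    by rewrite mxE (negPf ji) andbF scale0r.
  by rewrite /s (bigD1 i) //= addrCA lerDl addr_ge0 // sumr_ge0.
have sup0 : 0 < sup E by apply: lt_le_trans r00 _; exact: ub_le_sup.
have [_ [A [hA ->]] hdet] : exists2 r, E r & sup E - sup E / 2 < r.
  by apply: sup_adherent; [rewrite divr_gt0 | split => //; exists r0].
have det0 : 0 < `|\det A| by lra.
have Aunit : A \in unitmx by rewrite unitmxE unitfE -normr_gt0.
pose f i := comb e (row i A).
have combf a : comb f a = comb e (a *m A).
  rewrite mulmx_sum_row linear_sum /=; apply: eq_bigr => i _.
  by rewrite linearZ.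
exists f; split => // [a i|a]; last first.
  by exists (a *m invmx A); rewrite combf mulmxKV.
have [fa0|fa0] := eqVneq (comb f a) 0.
  move: (fa0); rewrite combf => /efree aA0.
  have -> : a = 0 by rewrite -(mulmxK Aunit a) aA0 mul0mx.
  by rewrite mxE normr0 mulr_ge0.
have nf0 : 0 < `|comb f a| by rewrite normr_gt0.
pose b := `|comb f a|^-1 *: a.
have fb : `|comb f b| = 1.
  by rewrite /b linearZ /= normrZ normfV normr_id mulVf // gt_eqF.
pose B := \matrix_(k, j) if k == i then (b *m A) ord0 j else A k j.
have : E `|\det B|.
  exists B; split => // k; rewrite /B.
  have [ki|ki] := eqVneq k i.
    rewrite (_ : row _ _ = b *m A) -?combf ?fb //.
    by apply/rowP => j; rewrite !mxE ki eqxx.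
  rewrite (_ : row _ _ = row k A) //.
  by apply/rowP => j; rewrite !mxE (negPf ki).
move=> /(ub_le_sup Ebd); rewrite det_replace_row normrM => hB.
have b2 : `|b ord0 i| <= 2.
  rewrite leNgt; apply/negP => b2; have : 2 * `|\det A| < `|b ord0 i| * `|\det A|.
    by rewrite ltr_pM2r.
  lra.
move: b2; rewrite mxE normrM normfV normr_id ler_pdivrMl // mulrC.
by [].
Qed.

(** * Bases, dimension and distortion *)

Lemma has_dim_basis (R : realType) (V : normedModType R) (n : nat) :
  has_dim V n -> exists2 e : 'I_n -> V, free_family e &
    forall x, exists a, x = comb e a.
Proof.
case=> -[phi philin [psi phiK psiK]].
have phi0 : phi 0 = 0 by have := philin (-1) 0 0; rewrite !scaleN1r !addNr.
have comb_psi a : comb (fun i => psi (delta_mx 0 i)) a = psi a.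
  apply: (can_inj phiK); rewrite psiK [RHS]row_sum_delta.
  have phiD x y : phi (x + y) = phi x + phi y.
    by have := philin 1 x y; rewrite !scale1r.
  have phiZ k x : phi (k *: x) = k *: phi x.
    by have := philin k x 0; rewrite phi0 !addr0.
  rewrite /comb (big_morph phi phiD phi0); apply: eq_bigr => i _.
  by rewrite phiZ psiK.
exists (fun i => psi (delta_mx 0 i)) => [a|x]; last first.
  by exists (phi x); rewrite comb_psi phiK.
by rewrite comb_psi => a0; rewrite -(psiK a) a0.
Qed.

Lemma basis_has_dim (R : realType) (V : normedModType R) (n : nat) (e : 'I_n -> V) :
  free_family e -> (forall x, exists a, x = comb e a) -> has_dim V n.
Proof.
move=> efree /choice[phi phiP].
have psiK a : phi (comb e a) = a.
  apply/eqP; rewrite -subr_eq0; apply/eqP/efree.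
  by rewrite linearB /= -phiP subrr.
split; exists phi; last by exists (comb e) => [x|a]; rewrite -?phiP ?psiK.
by move=> k x y; rewrite {1}(phiP x) {1}(phiP y) -linearP psiK.
Qed.

(** A free family that spans would give [V] a dimension, so some vector lies
outside its span and can be added. *)
Lemma infinite_dim_free (R : realType) (V : normedModType R) (n : nat) :
  infinite_dim V -> exists e : 'I_n -> V, free_family e.
Proof.
move=> Vinf; elim: n => [|n [e efree]].
  exists (fun=> 0) => a _; exact: thinmx0.
have [y ynot] : exists y, forall a, y <> comb e a.
  apply: contrapT => nex; apply: (Vinf n); apply: (basis_has_dim efree) => x.
  apply: contrapT => xnot; apply: nex; exists x => a xa; apply: xnot; by exists a.
pose e' (i : 'I_n.+1) := if unlift ord0 i is Some j then e j else y.
have comb' a : comb e' a = a ord0 ord0 *: y + comb e (\row_j a ord0 (lift ord0 j)).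
  rewrite /comb big_ord_recl /e' unlift_none; congr (_ + _).
  by apply: eq_bigr => j _; rewrite liftK mxE.
exists e' => a; rewrite comb' => /eqP.
have [a0|a0] := eqVneq (a ord0 ord0) 0.
  rewrite a0 scale0r add0r => /eqP/efree/rowP tail0.
  apply/rowP => i; rewrite [RHS]mxE.
  have [j ->|->] := unliftP ord0 i; last exact: a0.
  by have := tail0 j; rewrite !mxE.
rewrite addrC addr_eq0 => /eqP yE; exfalso.
apply: (ynot (- (a ord0 ord0)^-1 *: \row_j a ord0 (lift ord0 j))).
by rewrite linearZ /= yE scalerN scaleNr opprK scalerA mulVf // scale1r.
Qed.

(** Stated in coordinates, so that the linear map sending [e i] to [g i] need not
be constructed. *)
Lemma distortion_le (R : realType) (X Y : normedModType R) (n : nat)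
    (e : 'I_n -> X) (g : 'I_n -> Y) (s D : R) :
  (forall x, exists a, x = comb e a) -> 0 < s -> 1 <= D ->
  (forall a, s * `|comb e a| <= `|comb g a| <= D * (s * `|comb e a|)) ->
  (distortion (@norm_dist R X) (@norm_dist R Y) <= D%:E)%E.
Proof.
move=> /choice[phi phiP] s0 D1 bounds.
apply: ereal_inf_lbound; split; first by rewrite lee_fin.
exists (fun x => comb g (phi x)), s; split => // x y.
have -> : norm_dist x y = `|comb e (phi x - phi y)| by rewrite linearB /= -!phiP.
rewrite /norm_dist -linearB /= -EFinM lee_fin.
by have /andP[] := bounds (phi x - phi y).
Qed.

Lemma norm_rV_le (R : realType) (n : nat) (a : 'rV[R]_n) (c : R) :
  0 <= c -> (forall i, `|a ord0 i| <= c) -> `|a| <= c.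
Proof.
move=> c0 ac; rewrite /Num.norm /= mx_normrE; apply: bigmax_le => // -[i j] _ /=.
by rewrite ord1.
Qed.

Lemma norm_comb_le (R : realType) (V : normedModType R) (n : nat) (e : 'I_n -> V)
    (B c : R) (a : 'rV[R]_n) :
  0 <= B -> (forall i, `|e i| <= B) -> (forall i, `|a ord0 i| <= c) ->
  `|comb e a| <= n%:R * (c * B).
Proof.
move=> B0 eB ac; apply: le_trans (ler_norm_sum _ _ _) _.
apply: (@le_trans _ _ (\sum_(i < n) c * B)); last first.
  by rewrite sumr_const card_ord mulr_natl.
by apply: ler_sum => i _; rewrite normrZ ler_pM.
Qed.

(** Match near-Auerbach bases of the two spaces: when the vectors of a family have
norm at most 1 and the coordinates are at most twice the norm in the other space,
the norm grows by a factor at most 2 n, in either direction. *)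
Lemma distortion_le_dim (R : realType) (X Y : normedModType R) (n : nat)
    (e : 'I_n -> X) :
  (0 < n)%N -> (forall x, exists a, x = comb e a) ->
  (forall i, `|e i| <= 1) ->
  (forall (a : 'rV[R]_n) i, `|a ord0 i| <= 2 * `|comb e a|) ->
  infinite_dim Y ->
  (distortion (@norm_dist R X) (@norm_dist R Y) <= (4 * n%:R ^+ 2)%:E)%E.
Proof.
move=> n0 espan e1 e2 /infinite_dim_free -/(_ n)[g0 /near_auerbach[g [g1 g2 _]]].
have n1 : 1 <= n%:R :> R by rewrite ler1n.
have n0' : 0 < n%:R :> R by lra.
apply: (@distortion_le _ _ _ _ e g (2 * n%:R)^-1) => // [||a].
- by rewrite invr_gt0; lra.
- nra.
have := norm_comb_le ler01 e1 (g2 a); have := norm_comb_le ler01 g1 (e2 a).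
rewrite !mulr1 => h1 h2; rewrite mulrC ler_pdivrMr; last by lra.
apply/andP; split; first lra.
have -> : 4 * n%:R ^+ 2 * (`|comb e a| / (2 * n%:R)) = 2 * n%:R * `|comb e a|.
  by field; lra.
lra.
Qed.

(** * From the net to a linear embedding *)

Definition natv (R : realType) (n : nat) (b : 'rV[nat]_n) : 'rV[R]_n :=
  map_mx (fun k : nat => k%:R) b.

Lemma natvD (R : realType) (n : nat) (a b : 'rV[nat]_n) :
  natv R (a + b) = natv R a + natv R b.
Proof. by apply/rowP => i; rewrite !mxE natrD. Qed.

Lemma natv0 (R : realType) (n : nat) : natv R (0 : 'rV[nat]_n) = 0.
Proof. by apply/rowP => i; rewrite !mxE. Qed.

Lemma natvMn (R : realType) (n : nat) (a : 'rV[nat]_n) (k : nat) :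
  natv R (a *+ k) = k%:R *: natv R a.
Proof.
elim: k => [|k ih]; first by rewrite mulr0n natv0 scale0r.
by rewrite mulrS natvD ih -[k.+1%:R]nat1r scalerDl scale1r.
Qed.

Lemma comb_unitv (R : realType) (V : normedModType R) (n : nat) (e : 'I_n -> V)
    (i : 'I_n) : comb e (natv R (unitv i)) = e i.
Proof.
rewrite /comb (bigD1 i) //= big1 => [|j ji]; first by rewrite !mxE eqxx scale1r addr0.
by rewrite !mxE (negPf ji) scale0r.
Qed.

(** Round the positive and the negative part separately: signed lattice vectors
occur as differences of two vectors of natural numbers. *)
Lemma round_nat_diff (R : realType) (P : nat) (x : R) : `|x| <= 1 ->
  exists k l : nat, [/\ (k <= P)%N, (l <= P)%N & `|P%:R * x - (k%:R - l%:R)| <= 1].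
Proof.
wlog x0 : x / 0 <= x => [hw|] x1.
  have [x0|x0] := leP 0 x; first exact: hw.
  have [||k [l [kP lP h]]] := hw (- x); first by rewrite oppr_ge0 ltW.
    by rewrite normrN.
  by exists l, k; split => //; rewrite -normrN opprD opprB -mulrN addrC addrC.
have Px0 : 0 <= P%:R * x by rewrite mulr_ge0.
have /andP[lo hi] := truncn_itv Px0.
exists (Num.truncn (P%:R * x)), 0%N; split => //.
  rewrite -(ler_nat R); apply: le_trans lo _; rewrite ler_piMr //.
  by move: x1; rewrite ger0_norm.
rewrite subr0 ger0_norm ?subr_ge0 //; move: hi; rewrite -natr1; lra.
Qed.

(** The linear map sends [e i] to the increment of [w] in direction i.  By
homogeneity take max |a_i| = 1, so that |comb e a| >= 1/2.  Up to one unit in each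
coordinate P a is a difference of two points of the box; there [w] and the linear
map agree up to 1, and the rounding costs a multiple of D n.  In all the error is at
most 6 D n <= 12 D n |comb e a|. *)
Lemma linearization (R : realType) (X Y : normedModType R) (n P : nat)
    (e : 'I_n -> X) (D theta : R) (w : 'rV[nat]_n -> Y) :
  (2 <= n)%N -> (0 < P)%N -> 1 <= D -> 0 <= theta ->
  2 * theta * (n * P)%:R ^+ 2 <= 1 ->
  (forall i, `|e i| <= 1) ->
  (forall (a : 'rV[R]_n) i, `|a ord0 i| <= 2 * `|comb e a|) ->
  (forall b b', b \in box n P.+1 -> b' \in box n P.+1 ->
     2 * `|comb e (natv R b - natv R b')| - 1 <= `|w b - w b'|
       <= D * (2 * `|comb e (natv R b - natv R b')| + 1)) ->
  (forall a i j, a \in box n P.+1 ->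
     `|w (a + unitv i + unitv j) - w (a + unitv i) - (w (a + unitv j) - w a)|
       <= theta) ->
  exists g : 'I_n -> Y, forall a,
    (2 * P%:R - 12 * D * n%:R) * `|comb e a| <= P%:R * `|comb g a|
      <= (2 * D * P%:R + 12 * D * n%:R) * `|comb e a|.
Proof.
move=> n2 P0 D1 theta0 theta1 e1 e2 wb flat.
have n2R : 2 <= n%:R :> R by rewrite ler_nat.
have P0R : 0 < P%:R :> R by rewrite ltr0n.
pose g i := w (unitv i) - w 0; exists g.
have ubox i : unitv i \in box n P.+1 by case: (P) P0 => // P' _; exact: unitv_box.
have g3 i : `|g i| <= 3 * D.
  have /andP[_] := wb _ _ (ubox i) (box0 n P).
  rewrite natv0 subr0 comb_unitv => /le_trans; apply.
  by have := e1 i; nra.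
have aff b : b \in box n P.+1 ->
    `|w b - w 0 - comb g (natv R b)| <= theta * (n * P)%:R ^+ 2.
  move=> /(almost_affine theta0 flat); congr (`|_ - _| <= _).
  by apply: eq_bigr => i _; rewrite mxE.
have main a : `|a| = 1 ->
    2 * P%:R * `|comb e a| - 6 * D * n%:R <= P%:R * `|comb g a|
      <= 2 * D * P%:R * `|comb e a| + 6 * D * n%:R.
  move=> a1.
  have /choice[kl klP] : forall i, exists kl : nat * nat,
      [/\ (kl.1 <= P)%N, (kl.2 <= P)%N & `|P%:R * a ord0 i - (kl.1%:R - kl.2%:R)| <= 1].
    move=> i; have : `|a ord0 i| <= 1 by rewrite -a1 norm_coord.
    by move=> /(round_nat_diff P)[k [l ?]]; exists (k, l).
  pose b : 'rV[nat]_n := \row_i (kl i).1; pose b' : 'rV[nat]_n := \row_i (kl i).2.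
  have hb : b \in box n P.+1.
    by rewrite mem_box; apply/forallP => i; rewrite mxE ltnS; have [] := klP i.
  have hb' : b' \in box n P.+1.
    by rewrite mem_box; apply/forallP => i; rewrite mxE ltnS; have [] := klP i.
  pose d := P%:R *: a - (natv R b - natv R b').
  have d1 i : `|d ord0 i| <= 1 by rewrite /d !mxE; have [] := klP i.
  have aE : P%:R *: a = natv R b - natv R b' + d by rewrite /d addrC subrK.
  have ed : `|comb e d| <= n%:R.
    by have := norm_comb_le ler01 e1 d1; rewrite !mulr1.
  have gd : `|comb g d| <= n%:R * (3 * D).
    by have := norm_comb_le _ g3 d1; rewrite mul1r; apply; lra.
  have eE : P%:R * `|comb e a| = `|comb e (natv R b - natv R b') + comb e d|.
    by rewrite -linearD -aE linearZ /= normrZ ger0_norm.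
  have gE : P%:R * `|comb g a| = `|comb g (natv R b - natv R b') + comb g d|.
    by rewrite -linearD -aE linearZ /= normrZ ger0_norm.
  set E := comb e (natv R b - natv R b') in eE; set G := comb g (_ - _) in gE.
  have wG : `|w b - w b' - G| <= 1.
    have -> : w b - w b' - G = (w b - w 0 - comb g (natv R b))
        - (w b' - w 0 - comb g (natv R b')).
      rewrite /G linearB /= [w b - w 0 - _]addrAC [w b' - w 0 - _]addrAC.
      rewrite [in RHS]opprB [RHS]addrA subrK.
      by rewrite [X in _ = _ + X]opprD [RHS]addrACA [X in _ + X = _]opprD.
    apply: le_trans (ler_normB _ _) _.
    by have := lerD (aff b hb) (aff b' hb'); lra.
  have /andP[lo hi] := wb _ _ hb hb'; rewrite -/E in lo hi.
  have t1 := ler_normD E (comb e d).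
  have t2 := lerB_normD E (comb e d).
  have t3 := ler_normD G (comb g d).
  have t4 := lerB_normD G (comb g d).
  have := ler_dist_dist (w b - w b') G; rewrite ler_norml => /andP[t5 t6].
  have nD : n%:R <= D * n%:R by rewrite ler_peMl.
  have Dn : 2 * D <= D * n%:R by nra.
  rewrite -eE in t1 t2; rewrite -gE in t3 t4.
  set z := P%:R * `|comb e a| in t1 t2 *; set y := P%:R * `|comb g a| in t3 t4 *.
  have DE : D * `|E| <= D * z + D * n%:R by nra.
  apply/andP; split; last by rewrite -!mulrA -/z; nra.
  rewrite -!mulrA -/z; nra.
move=> a; have [->|a0] := eqVneq a 0; first by rewrite !linear0 !normr0 !mulr0 lexx.
have na0 : 0 < `|a| by rewrite normr_gt0.
have /main : `|(`|a|^-1 *: a)| = 1 by rewrite normrZ normfV normr_id mulVf // gt_eqF.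
rewrite [comb e (_ *: _)]linearZ [comb g (_ *: _)]linearZ /= !normrZ normfV normr_id.
have half : `|a| <= 2 * `|comb e a| by apply: norm_rV_le.
set r := `|a| in na0 half *; set z := r^-1 * `|comb e a|.
set y := r^-1 * `|comb g a|.
have rz : `|comb e a| = r * z by rewrite /z mulrA divff ?mul1r ?gt_eqF.
have ry : `|comb g a| = r * y by rewrite /y mulrA divff ?mul1r ?gt_eqF.
have z1 : 1 <= 2 * z by move: half; rewrite rz mulrCA -ler_pdivrMl // mulVf ?gt_eqF.
have Dn0 : 0 <= D * n%:R by rewrite mulr_ge0 //; lra.
have Dnz : D * n%:R <= D * n%:R * (2 * z) by rewrite ler_peMr.
rewrite rz ry => /andP[lo hi].
by apply/andP; split; rewrite [leLHS]mulrCA [leRHS]mulrCA ler_pM2l //; nra.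
Qed.

(** Compose [f] with a nearest point of the net and rescale by the mesh
2 delta.  Each lattice point moves by at most delta, hence distances between
lattice points change by at most one mesh. *)
Lemma net_to_lattice (R : realType) (X Y : normedModType R) (n Q : nat)
    (e : 'I_n -> X) (delta s D : R) (N : set X) (f : set_type N -> Y) :
  0 < delta -> unit_ball_net delta N -> 0 < s -> 1 <= D ->
  (forall x y, s * induced_dist x y <= norm_dist (f x) (f y)
                 <= D * (s * induced_dist x y)) ->
  (forall i, `|e i| <= 1) -> 2 * delta * (n * Q)%:R <= 1 ->
  exists F : 'rV[nat]_n -> Y, forall t t', t \in box n Q -> t' \in box n Q ->
    `|comb e (natv R t - natv R t')| - 1 <= `|F t - F t'|
      <= D * (`|comb e (natv R t - natv R t')| + 1).
Proof.
move=> delta0 [_ _ Ncov] s0 D1 fbi e1 small.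
pose pt t := (2 * delta) *: comb e (natv R t).
have ballE (x : X) : closed_ball (0 : X) 1 x <-> `|x| <= 1.
  by rewrite closed_ballE // /closed_ball_ /= sub0r normrN.
have [y0 [Ny0 _]] : exists y, N y /\ `|0 - y| <= delta.
  by apply: Ncov; rewrite ballE normr0.
have /choice[pi piP] : forall t, exists y : set_type N,
    t \in box n Q -> `|pt t - set_val y| <= delta.
  move=> t; have [tQ|tQ] := boolP (t \in box n Q); last first.
    by exists (SigSub (mem_set Ny0)).
  have [y [Ny ty]] : exists y, N y /\ `|pt t - y| <= delta.
    apply: Ncov; rewrite ballE normrZ gtr0_norm; last lra.
    apply: le_trans small; apply: ler_wpM2l; first lra.
    have tQR i : `|natv R t ord0 i| <= Q%:R.
      move: tQ; rewrite mem_box => /forallP /(_ i) tQ.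
      by rewrite mxE normr_nat ler_nat ltnW.
    by have := norm_comb_le ler01 e1 tQR; rewrite mulr1 natrM.
  by exists (SigSub (mem_set Ny)).
exists (fun t => (s * (2 * delta))^-1 *: f (pi t)) => t t' tQ tQ'.
have d2 : 0 < s * (2 * delta) by rewrite mulr_gt0 //; lra.
set c := comb e _.
have ptB : pt t - pt t' = (2 * delta) *: c by rewrite /pt /c linearB scalerBr.
have close1 : `|induced_dist (pi t) (pi t') - 2 * delta * `|c| | <= 2 * delta.
  have -> : 2 * delta * `|c| = `|pt t - pt t'|.
    by rewrite ptB normrZ gtr0_norm //; lra.
  apply: le_trans (ler_dist_dist _ _) _; rewrite distrC.
  have -> : pt t - pt t' - (set_val (pi t) - set_val (pi t'))
      = (pt t - set_val (pi t)) - (pt t' - set_val (pi t')).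
    by rewrite [X in _ + X = _]opprD [LHS]addrACA [X in _ = _ + X]opprD.
  apply: le_trans (ler_normB _ _) _.
  by have := piP t tQ; have := piP t' tQ'; lra.
rewrite -scalerBr normrZ gtr0_norm ?invr_gt0 //.
have /andP[lo hi] := fbi (pi t) (pi t').
move: close1; rewrite ler_norml => /andP[c1 c2].
have sc := ltW s0; rewrite -/(norm_dist _ _).
rewrite ler_pdivlMl // ler_pdivrMl //.
apply/andP; split.
  by apply: le_trans lo; nra.
apply: le_trans hi _.
have -> : s * (2 * delta) * (D * (`|c| + 1))
    = D * (s * (2 * delta * `|c| + 2 * delta)) by ring.
by rewrite ler_wpM2l ?ler_wpM2l //; lra.
Qed.

(** At a flat scale [k] and base point [t], rescale [F] on the multiples of
2^(k+1).  The defects for the pairs (e_i + e_j, 0) and (e_i, e_j) have the same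
midpoint, and twice their difference is the mixed second difference of the
rescaled map; eta = 1 / (8 (n P)^2) makes the affine approximation of
[linearization] accurate up to 1. *)
Lemma lattice_to_linear (R : realType) (X Y : normedModType R) (n m P : nat)
    (e : 'I_n -> X) (p K D : R) (F : 'rV[nat]_n -> Y) :
  (2 <= n)%N -> (0 < P)%N -> 0 < p -> 0 < K -> p_convex Y p K -> 1 <= D ->
  (forall i, `|e i| <= 1) ->
  (forall (a : 'rV[R]_n) i, `|a ord0 i| <= 2 * `|comb e a|) ->
  (forall t t', t \in box n (2 ^ m.+1 * P.+2 + 2) ->
      t' \in box n (2 ^ m.+1 * P.+2 + 2) ->
    `|comb e (natv R t - natv R t')| - 1 <= `|F t - F t'|
      <= D * (`|comb e (natv R t - natv R t')| + 1)) ->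
  (2 * n ^ 2 * (2 * P.+1) ^ n)%:R * K `^ p * (24 * D * (n * P)%:R ^+ 2) `^ p < m%:R ->
  exists g : 'I_n -> Y, forall a,
    (2 * P%:R - 12 * D * n%:R) * `|comb e a| <= P%:R * `|comb g a|
      <= (2 * D * P%:R + 12 * D * n%:R) * `|comb e a|.
Proof.
move=> n2 P0 p0 K0 cvx D1 e1 e2 Fbi hm.
have nP0 : 0 < (n * P)%:R :> R by rewrite ltr0n muln_gt0 P0 (ltn_trans _ n2).
pose eta : R := (8 * (n * P)%:R ^+ 2)^-1.
have eta0 : 0 < eta by rewrite invr_gt0 mulr_gt0 // exprn_gt0.
pose dir := ('I_n * 'I_n * bool)%type.
pose u (d : dir) := if d.2 then unitv d.1.1 + unitv d.1.2 else unitv d.1.1.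
pose v (d : dir) := if d.2 then 0 else unitv d.1.2.
have uv2 d i : (u d ord0 i <= 2)%N /\ (v d ord0 i <= 2)%N.
  case: d => [[j k] []]; rewrite /u /v /= ?coord_add_unitv !mxE;
    by split => //; case: (i == j); case: (i == k).
have box2 (w : 'rV[nat]_n) Q t : (forall i, (w ord0 i <= 2)%N) ->
    t \in box n Q -> t + w \in box n (Q + 2).
  rewrite !mem_box => w2 /forallP ht; apply/forallP => i; rewrite mxE.
  exact: leq_add (ht i) (w2 i).
have lip d t : t \in box n (2 ^ m.+1 * P.+2) -> `|F (t + u d) - F (t + v d)| <= 3 * D.
  move=> ht.
  have /andP[_] := Fbi _ _ (box2 (u d) _ _ (fun i => (uv2 d i).1) ht)
                           (box2 (v d) _ _ (fun i => (uv2 d i).2) ht).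
  move=> /le_trans; apply; rewrite [3 * D]mulrC ler_pM2l; last lra.
  have -> : natv R (t + u d) - natv R (t + v d) = natv R (u d) - natv R (v d).
    by rewrite !natvD opprD addrACA subrr add0r.
  have : `|comb e (natv R (u d) - natv R (v d))| <= 2.
    rewrite linearB /=; case: d => [[j k] []]; rewrite /u /v /=.
      rewrite natvD natv0 linearD linear0 /= !comb_unitv subr0.
      by apply: le_trans (ler_normD _ _) _; have := e1 j; have := e1 k; lra.
    rewrite !comb_unitv; apply: le_trans (ler_normB _ _) _.
    by have := e1 j; have := e1 k; lra.
  lra.
have D30 : 0 <= 3 * D by lra.
have count : (#|{: dir}| * (2 * P.+1) ^ n)%:R * K `^ p * (3 * D / eta) `^ p < m%:R.
  rewrite !card_prod !card_ord card_bool /eta invrK.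
  have -> : 3 * D * (8 * (n * P)%:R ^+ 2) = 24 * D * (n * P)%:R ^+ 2 by ring.
  by rewrite mulnn [(_ * 2)%N]mulnC.
have [k [t [km ht flat]]] := exists_flat_scale p0 K0 cvx D30 eta0 uv2 lip count.
have pow2 : 0 < 2 ^+ k :> R by rewrite exprn_gt0.
pose w b := (2 ^+ k)^-1 *: F (t + b *+ 2 ^ k.+1).
apply: (@linearization _ _ _ _ _ e D (4 * eta) w) => //.
- by rewrite mulr_ge0 // ltW.
- move: nP0; rewrite /eta; move: (n * P)%:R => x x0.
  by rewrite le_eqVlt; apply/orP; left; apply/eqP; field; rewrite gt_eqF.
- have tb b : b \in box n P.+1 -> t + b *+ 2 ^ k.+1 \in box n (2 ^ m.+1 * P.+2 + 2).
    have k2 : (2 ^ k.+1 <= 2 ^ m)%N by rewrite leq_exp2l.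
    move: ht; rewrite !mem_box => /forallP ht /forallP hb; apply/forallP => i.
    by rewrite coord_addMn [(2 ^ m.+1)%N]expnS; have := ht i; have := hb i; nia.
  move=> b b' hb hb'; have := Fbi _ _ (tb b hb) (tb b' hb').
  rewrite /w -scalerBr normrZ gtr0_norm ?invr_gt0 //.
  have -> : natv R (t + b *+ 2 ^ k.+1) - natv R (t + b' *+ 2 ^ k.+1)
      = (2 ^+ k * 2) *: (natv R b - natv R b').
    rewrite !natvD !natvMn opprD addrACA subrr add0r -scalerBr.
    by rewrite natrX exprSr.
  rewrite linearZ /= normrZ gtr0_norm ?mulr_gt0 // => /andP[lo hi].
  have k1 : 1 <= 2 ^+ k :> R by rewrite exprn_ege1 // ler1n.
  set x := 2 ^+ k in pow2 k1 lo hi *; set c := `|comb e _| in lo hi *.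
  rewrite ler_pdivlMl // ler_pdivrMl //; apply/andP; split.
    by apply: le_trans lo; lra.
  apply: le_trans hi _; rewrite [leRHS]mulrCA ler_pM2l; lra.
move=> a i j ha.
pose t' := t + a *+ 2 ^ k.+1.
have tE (b : 'rV[nat]_n) : t + (a + b) *+ 2 ^ k.+1 = t' + b *+ 2 ^ k.+1.
  by rewrite mulrnDl addrA.
have f1 := flat (i, j, true) a ha; have f2 := flat (i, j, false) a ha.
have -> : w (a + unitv i + unitv j) - w (a + unitv i) - (w (a + unitv j) - w a)
    = 2 *: (defect F (unitv i + unitv j) 0 k t' - defect F (unitv i) (unitv j) k t').
  rewrite /w -[a + _ + _]addrA !tE -/t' /defect addr0 mul0rn addr0.
  rewrite -!scalerBr scalerA exprS.
  rewrite mulrA divff ?mul1r // exprVn; congr (_ *: _).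
  rewrite [in RHS]opprB [RHS]addrA subrK [in LHS]opprB [LHS]addrACA.
  by rewrite [in RHS]opprD.
rewrite normrZ gtr0_norm //; apply: le_trans (ler_wpM2l _ (ler_normB _ _)) _ => //.
move: f1 f2; rewrite /u /v /= -/t'; lra.
Qed.

(** * The choice of the scales *)

(** With q = n / eps >= 2 every numerical constant is at most a power of q: P is about
q^9, and m is the integer following K^p q^(3 + 12 n + 31 p), in which q^3 and
q^(12 n) bound the number of tests and q^31 bounds L / eta. *)
Lemma scale_parameters (R : realType) (eps p K : R) (n : nat) :
  0 < eps < 1 -> 2 <= p -> 1 <= K -> (2 <= n)%N ->
  exists P m : nat, [/\ (0 < P)%N, 48 * n%:R ^+ 3 <= eps * P%:R,
    forall D : R, 1 <= D -> D <= 4 * n%:R ^+ 2 ->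
      (2 * n ^ 2 * (2 * P.+1) ^ n)%:R * K `^ p
        * (24 * D * (n * P)%:R ^+ 2) `^ p < m%:R &
    2 * expR (- (K `^ p * (n%:R / eps) `^ (50 * (n%:R + p))))
      * (n * (2 ^ m.+1 * P.+2 + 2))%:R <= 1].
Proof.
move=> /andP[eps0 eps1] p2 K1 n2.
have n2R : 2 <= n%:R :> R by rewrite ler_nat.
have [q qE] : exists q, q = n%:R / eps by exists (n%:R / eps).
rewrite -qE.
have nq : n%:R <= q by rewrite qE ler_pdivlMr //; nra.
have q2 : 2 <= q by lra.
have q0 : 0 < q by lra.
have q1 : 1 <= q by lra.
have qge0 : 0 <= q by lra.
have qpow i j : (i <= j)%N -> q ^+ i <= q ^+ j by move=> ij; rewrite ler_weXn2l.
have qS i (x : R) : x <= q ^+ i -> 2 * x <= q ^+ i.+1.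
  by move=> xi; rewrite exprS; have := exprn_ge0 i (ltW q0); nra.
have q9 : 0 <= q ^+ 9 by rewrite exprn_ge0 // ltW.
have [P Plo Phi] : exists2 P : nat, q ^+ 9 < P%:R & P%:R <= q ^+ 10.
  exists (Num.truncn (q ^+ 9)).+1; have /andP[lo hi] := truncn_itv q9 => //.
  have := qS 9 _ (lexx _); have := qpow 0%N 9%N isT; rewrite expr0 -natr1; lra.
have P1 : 1 <= P%:R :> R by have := qpow 0%N 9%N isT; rewrite expr0; lra.
have P0 : (0 < P)%N by rewrite -(ltr0n R); lra.
have Kp1 : 1 <= K `^ p by rewrite -(powRr0 K) ler_powR //; lra.
pose m0 := K `^ p * q `^ (3 + 12 * n%:R + 31 * p).
have m00 : 0 <= m0 by rewrite mulr_ge0 ?powR_ge0.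
have [m mhi mlo] : exists2 m : nat, m0 < m%:R & m%:R <= m0 + 1.
  exists (Num.truncn m0).+1; have /andP[lo hi] := truncn_itv m00 => //.
  by rewrite -natr1 lerD2r.
exists P, m; split => //.
- have epsq : eps * q = n%:R by rewrite qE mulrCA divff ?mulr1 // gt_eqF.
  have : eps * q ^+ 9 <= eps * P%:R by rewrite ler_wpM2l // ltW.
  rewrite exprS mulrA epsq; apply: le_trans.
  rewrite exprS mulrCA ler_wpM2l //.
  apply: (@le_trans _ _ (48 * q ^+ 2)).
    by rewrite ler_wpM2l // ler_pXn2r ?nnegrE //.
  have h := qS _ _ (qS _ _ (qS _ _ (qS _ _ (qS _ _ (qS _ _ (lexx (q ^+ 2))))))).
  by have := exprn_ge0 2 (ltW q0); lra.
- move=> D D1 D4; apply: le_lt_trans mhi.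
  have -> : m0 = q ^+ 3 * q ^+ 12 ^+ n * K `^ p * (q ^+ 31) `^ p.
    rewrite /m0 powRD; last by rewrite (gt_eqF q0) implybT.
    rewrite powRD; last by rewrite (gt_eqF q0) implybT.
    rewrite !powRrM !powR_mulrn ?exprn_ge0 ?powR_ge0 ?(ltW q0) //.
    ring.
  have base : 24 * D * (n * P)%:R ^+ 2 <= q ^+ 31.
    have h := qS _ _ (qS _ _ (qS _ _ (qS _ _ (qS _ _ (qS _ _ (qS _ _
      (lexx (q ^+ 24)))))))).
    apply: le_trans h; rewrite (_ : q ^+ 24 = (q ^+ 2 * q ^+ 10) ^+ 2); last by ring.
    rewrite natrM [(n%:R * P%:R) ^+ 2]exprMn [(_ * q ^+ 10) ^+ 2]exprMn.
    have n4 : D * n%:R ^+ 2 <= 4 * (q ^+ 2) ^+ 2.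
      have nq2 : n%:R ^+ 2 <= q ^+ 2 by rewrite ler_pXn2r ?nnegrE //.
      have := sqr_ge0 (n%:R : R); nra.
    have PP : P%:R ^+ 2 <= (q ^+ 10) ^+ 2 by rewrite ler_pXn2r ?nnegrE ?exprn_ge0 //.
    have : D * n%:R ^+ 2 * P%:R ^+ 2 <= 4 * (q ^+ 2) ^+ 2 * (q ^+ 10) ^+ 2.
      by apply: ler_pM => //; rewrite ?mulr_ge0 ?sqr_ge0 //; lra.
    have := mulr_ge0 (sqr_ge0 (q ^+ 2)) (sqr_ge0 (q ^+ 10)); lra.
  have base0 : 0 <= 24 * D * (n * P)%:R ^+ 2 by rewrite mulr_ge0 ?sqr_ge0 //; lra.
  apply: ler_pM; rewrite ?mulr_ge0 ?powR_ge0 //; last first.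
    apply: ge0_ler_powR => //; rewrite ?nnegrE ?exprn_ge0 ?(ltW q0) //; lra.
  rewrite ler_wpM2r ?powR_ge0 // !natrM !natrX.
  apply: ler_pM; rewrite ?mulr_ge0 ?exprn_ge0 //.
    by apply: (qS 2%N); rewrite -expr2 ler_pXn2r ?nnegrE //.
  apply: lerXn2r; rewrite ?nnegrE ?exprn_ge0 ?(ltW q0) //.
  rewrite natrM -natr1; have := qS _ _ (qS _ _ Phi); lra.
set B := K `^ p * _.
have E2 : 2 <= expR (1 : R) by have := @expR_ge1Dx R 1; lra.
have e2m : 2 ^+ m.+2 <= expR (m.+2)%:R :> R.
  rewrite -[X in expR X]mulr1 expRM_natl.
  by apply: lerXn2r; rewrite ?nnegrE ?expR_ge0 //; lra.
have eq13 : q ^+ 13 <= expR (q ^+ 13) by have := expR_ge1Dx (q ^+ 13); lra.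
have size : (2 * n * (2 ^ m.+1 * P.+2 + 2))%:R <= q ^+ 13 * 2 ^+ m.+2.
  have two1 : 1 <= 2 ^+ m.+1 :> R by rewrite exprn_ege1 // ler1n.
  rewrite !natrM natrD natrM natrX -[P.+2%:R]natr1 -natr1 [2 ^+ m.+2]exprS.
  have nP11 : n%:R * P%:R <= q ^+ 11 by rewrite [q ^+ 11]exprS ler_pM.
  have h := qS _ _ (qS _ _ nP11).
  have q2e : 4 <= q ^+ 2 by rewrite expr2; nra.
  have P4 : 4 <= P%:R :> R by have := qpow 2%N 9%N isT; lra.
  have nP : 4 * n%:R <= n%:R * P%:R :> R by rewrite mulrC ler_wpM2l.
  set T := 2 ^+ m.+1 in two1 *.
  have T0 : 0 <= T by lra.
  have nT : n%:R <= T * n%:R by rewrite ler_peMl.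
  have := ler_wpM2l T0 nP; have := ler_wpM2l T0 h; lra.
rewrite mulrAC -natrM mulnA expRN ler_pdivrMr ?expR_gt0 // mul1r.
apply: le_trans size _; apply: (@le_trans _ _ (expR (q ^+ 13 + m.+2%:R))).
  by rewrite expRD ler_pM // exprn_ge0 // ltW.
rewrite ler_expR.
(* q^(E - 2) dominates q^13, m0 / K^p and the constant 4, and the spare factor
   q^2 >= 4 absorbs the sum of the three terms. *)
set E := 50 * (n%:R + p) in B *.
have EE : q `^ E = q ^+ 2 * q `^ (E - 2).
  rewrite -powR_mulrn ?(ltW q0) // -powRD; last by rewrite (gt_eqF q0) implybT.
  by rewrite addrC subrK.
have t1 : q ^+ 13 <= q `^ (E - 2).
  by rewrite -powR_mulrn ?(ltW q0) // ler_powR // /E; lra.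
have t2 : q `^ (3 + 12 * n%:R + 31 * p) <= q `^ (E - 2).
  by rewrite ler_powR // /E; lra.
have t3 : 4 <= q `^ (E - 2).
  apply: le_trans t1; apply: le_trans (qpow 2%N 13%N isT); rewrite expr2; nra.
rewrite /B EE; set T := q `^ (E - 2) in t1 t2 t3 *.
have q4 : 4 <= q ^+ 2 by rewrite expr2; nra.
have KT : T <= K `^ p * T by rewrite ler_peMl //; lra.
have m0T : m0 <= K `^ p * T by rewrite /m0 ler_wpM2l //; lra.
have mm : m.+2%:R <= m0 + 3 by rewrite -!natr1; lra.
have : 4 * (K `^ p * T) <= q ^+ 2 * (K `^ p * T) by rewrite ler_wpM2r //; lra.
rewrite [K `^ p * (q ^+ 2 * T)]mulrCA; lra.
Qed.

(** * The discretization modulus *)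

Theorem mainTheorem2 (R : realType) :
  exists C : R, 1 < C /\
    forall (eps p K : R) (n : nat) (X : normedModType R)
      (Y : completeNormedModType R),
      0 < eps < 1 -> 2 <= p -> 1 <= K -> (2 <= n)%N ->
      has_dim X n -> infinite_dim Y ->
      (forall x y : Y,
         2 * `|x| `^ p + 2 / K `^ p * `|y| `^ p
           <= `|x + y| `^ p + `|x - y| `^ p) ->
      expR (- (K `^ p * (n%:R / eps) `^ (C * (n%:R + p))))
        <= discretization_modulus X Y eps.
Proof.
exists 50; split; first by rewrite ltr1n.
move=> eps p K n X Y eps01 p2 K1 n2 Xn Yinf cvx.
have [P [m [P0 Peps count small]]] := scale_parameters eps01 p2 K1 n2.
move: eps01 => /andP[eps0 eps1].
have n2R : 2 <= n%:R :> R by rewrite ler_nat.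
have [e0 e0free e0span] := has_dim_basis Xn.
have [e [e1 e2 espan0]] := near_auerbach e0free.
have espan x : exists a, x = comb e a.
  by have [a ->] := e0span x; exact: espan0.
set delta := expR _ in small *.
have delta0 : 0 < delta by exact: expR_gt0.
apply: ub_le_sup; first by exists 1 => d [/andP[_ /ltW]].
split.
  rewrite delta0 /delta expR_lt1 oppr_lt0 mulr_gt0 ?powR_gt0 ?divr_gt0 //; lra.
move=> N Nnet; apply: le_ereal_inf_tmp => -[r||] [r1 [f [s [s0 fbi]]]]; last 2 first.
- exact: leey.
- by move: r1; rewrite leNgt ltNyr.
rewrite lee_fin in r1.
have eps10 : (0 <= (1 - eps)%:E)%E by rewrite lee_fin; lra.
have [rbig|rsmall] := leP (4 * n%:R ^+ 2) r.
  have n0 : (0 < n)%N by exact: ltn_trans n2.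
  have := distortion_le_dim n0 espan e1 e2 Yinf.
  move=> /(lee_wpmul2l eps10) /le_trans; apply.
  rewrite -EFinM lee_fin; apply: le_trans rbig.
  by rewrite ler_piMl ?mulr_ge0 ?sqr_ge0 //; lra.
have K0 : 0 < K by lra.
have p0 : 0 < p by lra.
have fbi' x y : s * induced_dist x y <= norm_dist (f x) (f y)
    <= r * (s * induced_dist x y).
  by have [lo hi] := fbi x y; rewrite lo -lee_fin EFinM.
have [F Fbi] := net_to_lattice delta0 Nnet s0 r1 fbi' e1 small.
have [g gbi] :=
  lattice_to_linear n2 P0 p0 K0 cvx r1 e1 e2 Fbi (count r r1 (ltW rsmall)).
have P0R : 0 < P%:R :> R by rewrite ltr0n.
have rn : 12 * r * n%:R <= eps * P%:R.
  apply: le_trans Peps; rewrite exprSr; nra.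
have rn0 : 0 <= 12 * r * n%:R by rewrite mulr_ge0 //; lra.
have : (distortion (@norm_dist R X) (@norm_dist R Y) <= (r / (1 - eps))%:E)%E.
  apply: (@distortion_le _ _ _ _ e g ((2 * P%:R - 12 * r * n%:R) / P%:R)) => //.
  - by rewrite divr_gt0 //; nra.
  - by rewrite ler_pdivlMr; lra.
  move=> a; have /andP[lo hi] := gbi a; apply/andP; split.
    by rewrite mulrAC ler_pdivrMr // [leRHS]mulrC.
  set A := `|comb e a| in lo hi *.
  have -> : r / (1 - eps) * ((2 * P%:R - 12 * r * n%:R) / P%:R * A)
      = r * (2 * P%:R - 12 * r * n%:R) * A / (1 - eps) / P%:R.
    by field; apply/andP; split; apply/eqP; lra.
  rewrite ler_pdivlMr // [leLHS]mulrC; apply: le_trans hi _.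
  rewrite ler_pdivlMr; last lra.
  rewrite mulrAC ler_wpM2r ?normr_ge0 //.
  have : r * (12 * r * n%:R) <= r * (eps * P%:R) by rewrite ler_wpM2l //; lra.
  have : eps * P%:R <= r * (eps * P%:R) by rewrite ler_peMl // mulr_ge0 // ltW.
  nra.
move=> /(lee_wpmul2l eps10) /le_trans; apply.
by rewrite -EFinM lee_fin mulrC divfK // gt_eqF //; lra.
Qed.
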